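(* Let properties (P1)--(P15) listed in the context be fulfilled. For $\gamma>0$ and $k\in\mathbb N$, let $v_\gamma^k\in X_k$ be a global minimizer of $$\min_{v\in X_k}\; j(v)+\psi_\gamma(v)+\eta(v).$$ Then there exists a sequence $(\gamma_k)_{k\in\mathbb N}$ with $\gamma_k>0$ for all $k\in\mathbb N$ and $\lim_{k\to\infty}\gamma_k=0$ such that a subsequence of $(v_{\gamma_k}^k)_{k\in\mathbb N}$ converges (w.r.t. the strong topology in $W$, the weak topology in $X$, and the weak$^\ast$ topology in $Y$) to $\bar v$, where $\bar v$ is a global minimizer of $$\min_{v\in X\cap Z}\; j(v)+\beta\|v\|_Z+\eta(v).\qquad(\ast)$$ Furthermore, any subsequence of $(v_{\gamma_k}^k)_{k\in\mathbb N}$ that converges (w.r.t. the strong topology in $W$, the weak topology in $X$, and the weak$^\ast$ topology in $Y$) converges to a global minimizer of $(\ast)$.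
   Context: Properties: (P1) $X$ is a Hilbert space, $W$ is a separable Banach space, and the embedding $X\hookrightarrow W$ is compact. (P2) $Y$ is the dual of a separable Banach space (weak$^\ast$ convergence in $Y$ refers to this predual). (P3) The embedding $Y\hookrightarrow W$ is continuous. (P4) For each sequence $(v^k)_{k\in\mathbb N}\subset X\cap Y$ that converges weakly to $\hat v$ in $X$ and weakly$^\ast$ to $\bar v$ in $Y$, it holds that $\hat v=\bar v$ in $X\cap Y$. (P5) For each $\gamma>0$, $\psi_\gamma:Y\to\mathbb R\cup\{\infty\}$ is weakly$^\ast$ sequentially lower semicontinuous. (P6) $\eta:X\to\mathbb R$ is weakly lower semicontinuous. (P7) $j:Y\to\mathbb R$ is continuous w.r.t. the $W$-topology: if $(v^k)_{k\in\mathbb N}\subset Y$, $v\in Y$ and $v^k\to v$ strongly in $W$, then $j(v^k)\to j(v)$. (P8) The functions $j$, $\psi_\gamma$ ($\gamma>0$) and $\eta$ are bounded from below on $X\cap Y$. (P9) Boundedness of $(\psi_\gamma(v^k)+\eta(v^k))_{k\in\mathbb N}$ (for a sequence $(v^k)_{k\in\mathbb N}\subset X\cap Y$) implies boundedness of $(\|v^k\|_Y+\|v^k\|_X)_{k\in\mathbb N}$. (P10) $Z$ is a Banach space such that $Z\hookrightarrow Y$ (continuously). (P11) $X_k\subset X\cap Z$ ($k\in\mathbb N$) are subspaces such that $X_k\subset X_{k+1}$ for all $k$, and for all $w\in X\cap Z$ there exists a sequence $(w^k)_{k\in\mathbb N}$ with $w^k\in X_k$ such that $w^k\to w$ strongly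 in $X$ and $(\|w^k\|_Z)_{k\in\mathbb N}$ is bounded. (P12) For each $\gamma>0$, each bounded sequence $(v^k)_{k\in\mathbb N}\subset Z$ and $v\in Z$ such that $v^k\to v$ strongly in $W$, it follows that $\lim_{k\to\infty}\psi_\gamma(v^k)=\psi_\gamma(v)$. (P13) $\eta:X\to\mathbb R$ is strongly continuous. (P14) For each $v\in Y$, the map $(0,\infty)\ni\gamma\mapsto\psi_\gamma(v)$ is monotonically decreasing (i.e. nonincreasing). (P15) $\beta>0$ and $\psi_0:Y\to\mathbb R\cup\{\infty\}$ is such that $\psi_0(v)=\beta\|v\|_Z$ for all $v\in Z$ and $\psi_0(v)=\infty$ for all $v\in Y\setminus Z$; it holds that $\lim_{\gamma\to0^+}\psi_\gamma(v)=\psi_0(v)$ for arbitrary $v\in Y$. *)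

(* Defs.v *)
From HB Require Import structures.
From mathcomp Require Import all_boot all_order all_algebra sesquilinear.
From mathcomp Require Import all_classical all_reals all_analysis.

Set Implicit Arguments.
Unset Strict Implicit.
Unset Printing Implicit Defensive.

Import Order.TTheory GRing.Theory Num.Theory.
Import numFieldNormedType.Exports.

Local Open Scope classical_set_scope.
Local Open Scope ring_scope.

(* The spaces X, Y, Z are given abstractly together with continuous linear
   injections iX : X -> W, iY : Y -> W, iZ : Z -> Y.  Viewing them as subspaces
   of W, an element of X ∩ Y is a pair (x, y) : X * Y with iX x = iY y, and an
   element of X ∩ Z is a pair (x, z) : X * Z with iX x = iY (iZ z). *)

Definition separable (T : topologicalType) : Prop :=
  exists2 D : set T, countable D & dense D.

Definition continuous_embedding (R : realType) (A B : normedModType R)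
  (i : {linear A -> B}) : Prop := injective i /\ continuous i.

(* A compact linear map is automatically continuous. *)
Definition compact_embedding (R : realType) (A B : normedModType R)
  (i : {linear A -> B}) : Prop :=
  injective i /\ forall S : set A, bounded_set S -> precompact (i @` S).

Definition hilbert_norm (R : realType) (X : normedModType R)
  (dot : {dot X for (@idfun R)}) : Prop :=
  forall x : X, `|x| = Num.sqrt (dot x x).

Definition topological_dual (R : realType) (A : normedModType R) : Type :=
  {f : {linear A -> R^o} | continuous f}.

(* The weak topology: the coarsest one making all elements of the dual
   continuous. *)
Definition weak (R : realType) (A : normedModType R) : Type :=
  initial_topology (fun a : A =>
    (fun f : topological_dual A => sval f a) : {ptws topological_dual A -> R^o}).

HB.instance Definition _ (R : realType) (A : normedModType R) :=
  Topological.on (weak A).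

(* D identifies Y isometrically with the dual of V (injectivity of y |-> D y
   follows from the norm identity). *)
Definition dual_pairing (R : realType) (Y V : normedModType R)
  (D : {bilinear Y -> V -> R^o}) : Prop :=
  [/\ forall y : Y, continuous (D y),
      forall f : topological_dual V, exists y : Y, D y =1 sval f
    & forall y : Y, `|y| = sup [set `|D y v| | v in [set v : V | `|v| <= 1]]].

(* The weak* topology on Y relative to the predual V: pointwise convergence
   on V. *)
Definition weak_star (R : realType) (Y V : normedModType R)
  (D : {bilinear Y -> V -> R^o}) : Type :=
  initial_topology (fun y : Y => (D y : {ptws V -> R^o})).

HB.instance Definition _ (R : realType) (Y V : normedModType R)
  (D : {bilinear Y -> V -> R^o}) := Topological.on (weak_star D).

Definition weak_cvg (R : realType) (A : normedModType R)
  (u : nat -> A) (a : A) : Prop :=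
  (u : nat -> weak A) @ \oo --> (a : weak A).

Definition weak_star_cvg (R : realType) (Y V : normedModType R)
  (D : {bilinear Y -> V -> R^o}) (u : nat -> Y) (y : Y) : Prop :=
  (u : nat -> weak_star D) @ \oo --> (y : weak_star D).

Definition weak_lsc (R : realType) (A : normedModType R) (f : A -> R) : Prop :=
  lower_semicontinuous ((fun a => (f a)%:E) : weak A -> \bar R).

Definition weak_star_seq_lsc (R : realType) (Y V : normedModType R)
  (D : {bilinear Y -> V -> R^o}) (f : Y -> \bar R) : Prop :=
  forall (u : nat -> Y) (y : Y), weak_star_cvg D u y ->
    (f y <= limn_einf (f \o u))%E.

Definition capXY (R : realType) (W X Y : normedModType R)
  (iX : {linear X -> W}) (iY : {linear Y -> W}) : set (X * Y) :=
  [set p | iX p.1 = iY p.2].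

Definition capXZ (R : realType) (W X Y Z : normedModType R)
  (iX : {linear X -> W}) (iY : {linear Y -> W}) (iZ : {linear Z -> Y}) :
  set (X * Z) :=
  [set p | iX p.1 = iY (iZ p.2)].

Definition XZ_to_XY (R : realType) (X Y Z : normedModType R)
  (iZ : {linear Z -> Y}) (p : X * Z) : X * Y := (p.1, iZ p.2).

Definition linear_subspace (R : realType) (A : normedModType R) (S : set A) :
  Prop := submod_closed [pred a : A | a \in S].

(* Convergence in X ∩ Y simultaneously in the strong topology of W, the weak
   topology of X and the weak* topology of Y. *)
Definition cvg_WXY (R : realType) (W X Y V : normedModType R)
  (iX : {linear X -> W}) (D : {bilinear Y -> V -> R^o})
  (u : nat -> X * Y) (p : X * Y) : Prop :=
  [/\ (fun k => iX (u k).1) @ \oo --> iX p.1,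
      weak_cvg (fun k => (u k).1) p.1
    & weak_star_cvg D (fun k => (u k).2) p.2].

Definition global_minimizer (T : Type) (d : Order.disp_t) (E : porderType d)
  (S : set T) (F : T -> E) (v : T) : Prop :=
  S v /\ forall w : T, S w -> (F v <= F w)%O.

Definition objective (R : realType) (X Y Z : normedModType R)
  (iZ : {linear Z -> Y}) (j : Y -> R) (psi : Y -> \bar R) (eta : X -> R)
  (p : X * Z) : \bar R :=
  ((j (iZ p.2))%:E + psi (iZ p.2) + (eta p.1)%:E)%E.

Definition limit_objective (R : realType) (X Y Z : normedModType R)
  (iZ : {linear Z -> Y}) (j : Y -> R) (beta : R) (eta : X -> R)
  (p : X * Z) : R :=
  j (iZ p.2) + beta * `|p.2| + eta p.1.

(* Main.v *)
(** Let [m] be the infimum of the limit objective.  For fixed [gamma], testing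
    the minimality of [v gamma k] with the recovery sequence of a near-minimizer,
    and using [psi gamma <= psi0], the discrete minimal values are eventually at
    most [m + e]; a diagonal choice [gamma k -> 0] keeps this property.  The
    resulting minimizers are bounded in [X] and [Y] because
    [psi 1 <= psi (gamma k)], hence have a convergent subsequence.  At any limit
    [q] of a subsequence, lower semicontinuity of [psi d] for each fixed [d]
    gives [j + psi d + eta <= m] at [q]; letting [d] go to [0], [psi0 q] is
    finite, so [q] lies in [Z] and attains [m]. *)
Require Import Defs.
From HB Require Import structures.
From mathcomp Require Import all_boot all_order all_algebra sesquilinear.
From mathcomp Require Import all_classical all_reals all_analysis.
From mathcomp Require Import ring lra.

Set Implicit Arguments.
Unset Strict Implicit.
Unset Printing Implicit Defensive.
Import Order.TTheory GRing.Theory Num.Theory.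
Import numFieldNormedType.Exports.
Local Open Scope classical_set_scope.
Local Open Scope ring_scope.

(** * Initial topologies, ultrafilters, diagonal choice and one-sided limits *)

Lemma initial_cvg (S : choiceType) (T : topologicalType) (f : S -> T)
    (F : set_system S) (s : S) : Filter F ->
  f @ F --> f s -> F --> (s : initial_topology f).
Proof.
move=> FF fF A; rewrite nbhsE => -[B [[C oC <-] Cfs] CA].
by apply: filterS CA _; apply: fF; exact: open_nbhs_nbhs.
Qed.

Lemma ptws_cvg (U : Type) (T : topologicalType) (F : set_system (U -> T))
    (f : U -> T) : Filter F ->
  (forall u, (fun g => g u) @ F --> f u) -> F --> (f : {ptws U -> T}).
Proof.
by move=> FF Ff; apply/cvg_sup => u; apply: initial_cvg; exact: Ff.
Qed.

Lemma weak_cvgW (R : realType) (A : normedModType R) (u : nat -> A) (a : A) :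
  (forall f : topological_dual A,
    (fun n => sval f (u n)) @ \oo --> sval f a) ->
  weak_cvg u a.
Proof.
move=> h; apply: initial_cvg; apply: ptws_cvg => f; exact: h.
Qed.

Lemma weak_star_cvgW (R : realType) (Y V : normedModType R)
    (D : {bilinear Y -> V -> R^o}) (u : nat -> Y) (y : Y) :
  (forall v, (fun n => D (u n) v) @ \oo --> D y v) -> weak_star_cvg D u y.
Proof.
move=> h; apply: initial_cvg; apply: ptws_cvg => f; exact: h.
Qed.

(** For each neighbourhood [A] of a cluster point, the ultrafilter contains the preimage of [A] or
    its complement; clustering rules out the latter, so the cluster point is a limit. *)
Lemma ultra_cvg_compact (T : Type) (U : topologicalType) (F : set_system T)
    (f : T -> U) (K : set U) : UltraFilter F -> compact K ->
  (forall t, K (f t)) -> exists2 p, K p & f @ F --> p.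
Proof.
move=> FU cK Kf; have FF := @ultra_proper _ _ FU.
have FK : (f @ F) K.
  by apply: (@filterS _ F _ setT) => [t _|]; [exact: Kf|exact: filterT].
have [p [Kp clp]] := cK (f @ F) _ FK.
exists p => // A pA.
have [//|FA] := in_ultra_setVsetC (f @^-1` A) FU.
by have [x []] := clp (~` A) A FA pA.
Qed.

(** [N k] is the largest [n <= k] whose threshold [K n] is at most [k]. Every fixed [n] eventually
    competes, so [N] tends to infinity. *)
Lemma diagonal_index (P : nat -> nat -> Prop) :
  (forall n, \forall k \near \oo, P n k) ->
  exists N : nat -> nat,
    (forall n, \forall k \near \oo, (n <= N k)%N) /\
    \forall k \near \oo, P (N k) k.
Proof.
move=> hP.
have /choice[K hK] n : exists K, forall k, (K <= k)%N -> P n k.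
  by have [K _ hK] := hP n; exists K.
have hN k : exists m, (m <= k)%N /\ ((K 0 <= k)%N -> (K m <= k)%N) /\
    forall n, (n <= k)%N -> (K n <= k)%N -> (n <= m)%N.
  (* If [k < K 0] there may be no competitor; [m] then only has to dominate all of them, which
     concerns finitely many [k]. *)
  have [K0|K0] := leqP (K 0) k; last first.
    have [|b|m mk mmax] := @ex_maxnP (fun n => (n <= k)%N) k; first by exists 0.
      by [].
    by exists m; split=> //; split=> // n nk _; exact: mmax.
  have [|b /andP[]//|m /andP[mk Km] mmax] :=
    @ex_maxnP (fun n => (n <= k) && (K n <= k))%N k; first by exists 0.
  by exists m; split=> //; split=> // n nk Kn; apply: mmax; rewrite nk.
have /choice[N hNN] := hN; exists N; split.
  move=> n; exists (maxn n (K n)) => // k /=; rewrite geq_max => /andP[nk Kk].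
  by have [_ [_ h]] := hNN k; exact: h.
exists (K 0) => // k /= K0; apply: hK.
by have [_ [h _]] := hNN k; exact: h.
Qed.

Lemma limn_einf_gt (R : realType) (u : nat -> \bar R) (c : \bar R) :
  (c < limn_einf u)%E -> \forall n \near \oo, (c < u n)%E.
Proof.
rewrite limn_einf_lim (cvg_lim _ (@cvg_einfs_sup _ u))//.
move=> /ereal_sup_gt[_ [n _ <-] cn].
exists n => // k /= nk; apply: lt_le_trans cn _.
by apply: ereal_inf_lbound; exists k.
Qed.

Lemma nonincreasing_at_right_le (R : realType) (f : R -> \bar R) (l : \bar R)
    (a : R) : 0 < a ->
  (forall x y, 0 < x -> x <= y -> (f y <= f x)%E) ->
  f x @[x --> 0^'+] --> l -> (f a <= l)%E.
Proof.
move=> a0 fni fl.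
rewrite -(cvg_lim _ fl)//; apply: lime_ge; first by apply/cvg_ex; exists l.
near=> x; apply: fni; first by near: x; exact: nbhs_right_gt.
by near: x; exact: nbhs_right_le.
Unshelve. all: by end_near. Qed.

(** * Weak convergence in a Hilbert space *)

Lemma parallelogram (R : realType) (X : normedModType R)
    (dot : {dot X for (@idfun R)}) : hilbert_norm dot ->
  forall x y : X, `|x + y| ^+ 2 + `|x - y| ^+ 2 = (`|x| ^+ 2 + `|y| ^+ 2) *+ 2.
Proof.
move=> h x y.
have dot_ge0 z : 0 <= dot z z.
  have [->|z0] := eqVneq z 0; first by rewrite linear0r.
  exact/ltW/neq0_dnorm_gt0.
rewrite !h !sqr_sqrtr//.
rewrite !(linearDl, linearDr, linearNl, linearNr)/=; ring.
Qed.

(* Almost-minimizers of the norm: midpoints stay in the set, so the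
   parallelogram law forces them to be Cauchy. *)
Lemma midpoint_closed_cvg (R : realType) (X : completeNormedModType R)
    (A : nat -> set X) (M : R) :
  (forall x y : X, `|x + y| ^+ 2 + `|x - y| ^+ 2 =
                   (`|x| ^+ 2 + `|y| ^+ 2) *+ 2) ->
  (forall n, A n !=set0) -> (forall n, A n.+1 `<=` A n) ->
  (forall n x, A n x -> `|x| <= M) ->
  (forall n x y, A n x -> A n y -> A n (2^-1 *: (x + y))) ->
  exists (a : nat -> X) (x : X), (forall n, A n (a n)) /\ a @ \oo --> x.
Proof.
move=> par A0 decA AM mid.
have decA' m n : (m <= n)%N -> A n `<=` A m.
  move=> /subnK <-; elim: (n - m)%N => // k IH x; rewrite addSn.
  by move/decA/IH.
pose S n := [set `|x| ^+ 2 | x in A n]; pose d n := inf (S n).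
(* The sets shrink, so [d] is nondecreasing; it is bounded by [M ^+ 2], hence converges. *)
have S0 n : S n !=set0 by have [x Ax] := A0 n; exists (`|x| ^+ 2); exists x.
have lbS n : has_lbound (S n) by exists 0 => _ [x _ <-]; exact: sqr_ge0.
have d_le n x : A n x -> d n <= `|x| ^+ 2.
  by move=> Ax; apply: ge_inf => //; exists x.
have d_homo : {homo d : n m / (n <= m)%N >-> n <= m}.
  move=> n m nm; apply: lb_le_inf => // _ [x Ax <-]; apply: d_le.
  exact: decA' Ax.
have d_bnd : has_ubound (range d).
  exists (M ^+ 2) => _ [n _ <-]; have [x Ax] := A0 n.
  rewrite (le_trans (d_le _ _ Ax))// lerXn2r ?nnegrE//.
    by rewrite (le_trans _ (AM _ _ Ax)).
  exact: AM Ax.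
have d_cvg := nondecreasing_is_cvgn d_homo d_bnd.
have d_lim := nondecreasing_cvgn_le d_homo d_cvg.
have /choice[a aP] n : exists x, A n x /\ `|x| ^+ 2 < d n + n.+1%:R^-1.
  have [|_ [x Ax <-] xd] :=
      @inf_adherent _ (S n) n.+1%:R^-1 _ (conj (S0 n) (lbS n)).
    by rewrite invr_gt0.
  by exists x.
(* The midpoint of [a n] and [a m] lies in [A N], so its squared norm is at least [d N]; the
   parallelogram law turns this into a bound on the distance, whence the factor 4. *)
have near_a N n m : (N <= n)%N -> (N <= m)%N ->
    `|a n - a m| ^+ 2 <= (limn d - d N + N.+1%:R^-1) *+ 4.
  move=> Nn Nm.
  have [An dn] := aP n; have [Am dm] := aP m.
  have := d_le N _ (mid _ _ _ (decA' _ _ Nn _ An) (decA' _ _ Nm _ Am)).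
  have half2 : (2^-1 : R) ^+ 2 = 4^-1 by rewrite exprVn -natrX.
  rewrite normrZ exprMn ger0_norm// half2 => dN.
  have := par (a n) (a m).
  have := d_lim n; have := d_lim m.
  have in_ k : (N <= k)%N -> k.+1%:R^-1 <= N.+1%:R^-1 :> R.
    by move=> Nk; rewrite lef_pV2 ?posrE// ler_nat.
  have := in_ _ Nn; have := in_ _ Nm.
  move: dN dn dm; move: (m.+1%:R^-1) (n.+1%:R^-1) (N.+1%:R^-1) (limn d).
  move: (`|a n + a m| ^+ 2) (`|a n - a m| ^+ 2) (`|a n| ^+ 2) (`|a m| ^+ 2).
  by move: (d n) (d m) (d N) => *; lra.
have : cvg (a @ \oo).
  apply: cauchy_cvg; apply: cauchy_exP => e e0.
  have e40 : 0 < e ^+ 2 / 4 by rewrite divr_gt0 ?exprn_gt0.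
  have : (fun n => limn d - d n + n.+1%:R^-1) @ \oo --> (0 : R).
    rewrite -[X in _ --> X](addr0 0) -{1}(subrr (limn d)).
    by apply: cvgD; [apply: cvgB => //; exact: cvg_cst|exact: cvg_harmonic].
  move=> /cvgr_lt /(_ _ e40) [N _ hN].
  exists (a N); exists N => // n /= Nn; rewrite -ball_normE /=.
  rewrite -(ltr_pXn2r (n := 2)) ?nnegrE ?(ltW e0)//.
  apply: le_lt_trans (near_a N N n (leqnn N) Nn) _.
  by rewrite -(mulr_natr _ 4) -ltr_pdivlMr//; exact: (hN _ (leqnn N)).
by move=> /cvg_ex[x ax]; exists a, x; split => // n; case: (aP n).
Qed.

(** The image of the unit ball is precompact, hence bounded. *)
Lemma compact_embedding_continuous (R : realType) (A B : normedModType R)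
    (i : {linear A -> B}) : compact_embedding i -> continuous i.
Proof.
move=> [_ hc]; apply/linear_bounded_continuous.
have /hc : bounded_set [set x : A | `|x| <= 1].
  by exists 1; split=> // M M1 x /= /le_trans; apply; exact: ltW.
rewrite precompactE => /compact_bounded/pinfty_ex_gt0[M M0 hM].
exists M; split; first exact: gtr0_real.
move=> M' MM'; near=> x; rewrite /= (le_trans _ (ltW MM'))//.
apply: hM; apply: subset_closure; exists x; last by [].
by near: x; exact: nbhs0_le.
Unshelve. all: by end_near. Qed.

(** [midpoint_closed_cvg] applies to the points of [C] of norm at most [M] whose image is within
    [1/(n+1)] of [w]. Membership in [C] is claimed for the approximants [a n] only; continuity of
    [i] sends their limit to [w]. *)
Lemma hilbert_adherent_preimage (R : realType) (X : completeNormedModType R)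
    (W : normedModType R) (dot : {dot X for (@idfun R)})
    (i : {linear X -> W}) (C : set X) (w : W) (M : R) :
  hilbert_norm dot -> continuous i ->
  (forall x y, C x -> C y -> C (2^-1 *: (x + y))) ->
  (forall e, 0 < e -> exists x, [/\ C x, `|x| <= M & `|i x - w| <= e]) ->
  exists (a : nat -> X) (x : X),
    [/\ forall n, C (a n), a @ \oo --> x & i x = w].
Proof.
move=> hX ci Cmid CM.
have half_norm (E : normedModType R) (x y : E) (r : R) :
    `|x| <= r -> `|y| <= r -> `|2^-1 *: (x + y)| <= r.
  move=> xr yr; rewrite normrZ ger0_norm// mulrC ler_pdivrMr//.
  by rewrite (le_trans (ler_normD _ _))// mulr_natr mulr2n lerD.
pose A n := [set x | [/\ C x, `|x| <= M & `|i x - w| <= n.+1%:R^-1]].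
have [||||a [x [Aa ax]]] :=
    @midpoint_closed_cvg _ X A M (parallelogram hX).
- by move=> n; have [|x ?] := CM n.+1%:R^-1; [rewrite invr_gt0|exists x].
- move=> n x [Cx xM xw]; split => //; rewrite (le_trans xw)//.
  by rewrite lef_pV2 ?posrE// ler_nat.
- by move=> n x [].
- move=> n x y [Cx xM xw] [Cy yM yw]; split; [exact: Cmid|exact: half_norm|].
  have -> : i (2^-1 *: (x + y)) - w = 2^-1 *: ((i x - w) + (i y - w)).
    rewrite linearZ linearD/= addrACA -opprD scalerBr -mulr2n.
    by rewrite -(scaler_nat 2 w) scalerA mulVf// scale1r.
  exact: half_norm.
exists a, x; split=> //; first by move=> n; case: (Aa n).
have iax : i \o a @ \oo --> i x by apply: cvg_comp ax _; exact: ci.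
apply: cvg_unique iax _; first exact: norm_hausdorff.
apply/cvgrPdist_le => e e0.
have : (fun n => n.+1%:R^-1) @ \oo --> (0 : R) by exact: cvg_harmonic.
move=> /cvgr_le /(_ _ e0); apply: filterS => n ne.
by rewrite distrC (le_trans _ ne)//; case: (Aa n).
Qed.

(* [xhat] is found by minimizing the norm on nearly-preimages of [w]; running
   the same construction inside a half-space [s f x >= s f xhat + e] would give
   a second preimage of [w] there, so the sequence eventually leaves every such
   half-space.  No representation theorem for the dual is needed. *)
Lemma hilbert_bounded_weak_cvg (R : realType) (X : completeNormedModType R)
    (W : normedModType R) (dot : {dot X for (@idfun R)})
    (i : {linear X -> W}) (x : nat -> X) (w : W) (M : R) :
  hilbert_norm dot -> injective i -> continuous i ->
  (forall n, `|x n| <= M) -> i \o x @ \oo --> w ->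
  exists2 xhat, i xhat = w & weak_cvg x xhat.
Proof.
move=> hX inji ci xM ixw.
have [//||_ [xhat [_ _ ixhat]]] :=
    hilbert_adherent_preimage (C := setT) (w := w) (M := M) hX ci.
  move=> e e0; have /cvgr_distC_le/(_ _ e0)[N _ hN] := ixw.
  by exists (x N); split => //; exact: (hN _ (leqnn N)).
exists xhat => //; apply: weak_cvgW => f.
have half (s e : R) : 0 < e ->
    \forall n \near \oo, s * sval f (x n) < s * sval f xhat + e.
  move=> e0; apply: contrapT => nlt.
  pose C := [set z | s * sval f xhat + e <= s * sval f z].
  have [||a [z [Ca az iz]]] :=
      hilbert_adherent_preimage (C := C) (w := w) (M := M) hX ci.
  - move=> y z; rewrite /C /= linearZ linearD /=.
    by rewrite -[_ *: _]/(_ * _); nra.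
  - move=> e' e'0; have /cvgr_distC_le/(_ _ e'0)[N _ hN] := ixw.
    have [n Nn nC] : exists2 n, (N <= n)%N & C (x n).
      apply: contrapT => h; apply: nlt; exists N => // n /= Nn.
      by rewrite ltNge; apply/negP => xC; apply: h; exists n.
    by exists (x n); split => //; exact: hN.
  (* Injectivity makes [z] equal to [xhat], while [f] is continuous and every [a n] lies in the
     half-space; passing to the limit contradicts [0 < e]. *)
  have zE : z = xhat by apply: inji; rewrite iz.
  have : (fun n => s * sval f (a n)) @ \oo --> s * sval f xhat.
    apply: cvgMr; rewrite -zE; apply: (cvg_comp _ _ az); exact: (svalP f).
  move=> saf.
  have : s * sval f xhat + e <= limn (fun n => s * sval f (a n)).
    apply: limr_ge; last exact: nearW.
    by apply/cvg_ex; exists (s * sval f xhat).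
  by rewrite (cvg_lim _ saf)//; lra.
(* The signs [s = 1] and [s = -1] bound the difference from both sides. *)
apply/cvgrPdist_lt => e e0; near=> n.
rewrite ltr_norml; apply/andP; split.
  have : 1 * sval f (x n) < 1 * sval f xhat + e.
    by near: n; exact: half.
  lra.
have : -1 * sval f (x n) < -1 * sval f xhat + e.
  by near: n; exact: half.
lra.
Unshelve. all: by end_near. Qed.

(** * Dual pairings and weak-star sequential compactness *)

Lemma dual_pairing_le (R : realType) (Y V : normedModType R)
    (D : {bilinear Y -> V -> R^o}) : dual_pairing D ->
  forall y v, `|D y v| <= `|y| * `|v|.
Proof.
move=> [Dc _ Dn] y v.
(* Continuity bounds the set under [sup]; the supremum of an unbounded set would be the default
   [0]. *)
have [r r0 hr] : exists2 r, 0 < r & forall v, `|D y v| <= r * `|v|.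
  have /linear_bounded_continuous/linear_boundedP := Dc y.
  by move=> /pinfty_ex_gt0[r r0 hr]; exists r.
have [->|v0] := eqVneq v 0; first by rewrite linear0r !normr0 mulr0.
have nv0 : 0 < `|v| by rewrite normr_gt0.
rewrite -ler_pdivrMr// Dn; apply: ub_le_sup.
  exists r => _ [z /= z1 <-]; rewrite (le_trans (hr z))//.
  by rewrite ler_piMr// ltW.
exists (`|v|^-1 *: v) => /=.
  by rewrite normrZ normfV normr_id mulVf ?gt_eqF.
by rewrite linearZr_LR /= normrZ normfV normr_id mulrC.
Qed.

(** Finite intersections of members of [U] stay in [U] and meet every tail, so [phi m] can be taken
    beyond the previous index and in [P l m] for all [l <= m] at once. *)
Lemma filter_subsequence (U : set_system nat) (P : nat -> nat -> set nat) :
  ProperFilter U -> \oo `<=` U -> (forall l m, U (P l m)) ->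
  exists phi : nat -> nat, {homo phi : m n / (m < n)%N} /\
    forall l m, (l <= m)%N -> P l m (phi m).
Proof.
move=> PU ooU UP.
have UPm m k : U [set n | forall l, (l < k)%N -> P l m n].
  elim: k => [|k IH]; first by apply: filterS filterT.
  apply: filterS2 IH (UP k m) => n hn Pn l; rewrite ltnS leq_eqVlt.
  by case/orP => [/eqP->//|]; exact: hn.
have /choice[h hP] (mN : nat * nat) : exists n, (mN.2 < n)%N /\
    forall l, (l <= mN.1)%N -> P l mN.1 n.
  have /ooU UN : (\oo : set_system nat) [set n | (mN.2 < n)%N] by exists mN.2.+1.
  have [n [Nn nP]] := filter_ex (filterI UN (UPm mN.1 mN.1.+1)).
  by exists n.
pose phi := fix phi m := if m is k.+1 then h (k.+1, phi k) else h (0, 0).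
exists phi; split.
  apply: homo_ltn => [? ? ?|m]; first exact: ltn_trans.
  by case: (hP (m.+1, phi m)).
by move=> l [|m]; [case: (hP (0, 0)) => _|case: (hP (m.+1, phi m)) => _]; exact.
Qed.

Lemma dual_of_bounded (R : realType) (V : normedModType R) (L : V -> R) (M : R) :
  linear (L : V -> R^o) -> (forall v, `|L v| <= M * `|v|) ->
  exists f : topological_dual V, sval f =1 L.
Proof.
move=> linL LM.
pose Lm := GRing.isLinear.Build R V R^o *:%R L linL.
pose f : {linear V -> R^o} := HB.pack L Lm.
have cf : continuous f.
  apply/linear_bounded_continuous/linear_boundedP.
  exists M; split; first exact: num_real.
  move=> r Mr v; rewrite (le_trans (LM v))// ler_wpM2r// ltW//.
by exists (exist _ f cf).
Qed.

Lemma separable_dense_seq (T : ptopologicalType) : separable T ->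
  exists e : nat -> T, forall (x : T) A, nbhs x A -> exists n, A (e n).
Proof.
move=> [D /pfcard_geP[->|[e]] dD].
  (* A pointed space is nonempty, so a dense set cannot be empty. *)
  by have [x [_ []]] := dD setT (ex_intro _ point Logic.I) openT.
exists e => x A; rewrite nbhsE => -[B [oB Bx] BA].
have [y [By Dy]] := dD B (ex_intro _ x Bx) oB.
have [n _ en] := 'surj_e Dy.
by exists n; apply: BA; rewrite en.
Qed.

(* All the limits are first taken along one ultrafilter finer than [\oo]; the
   subsequence is then chosen once and for all so as to approach them on a
   dense sequence, without nested extractions. *)
Lemma bounded_subsequence (R : realType) (X W V Y : normedModType R)
    (D : {bilinear Y -> V -> R^o}) (i : {linear X -> W})
    (u : nat -> X * Y) (M : R) :
  compact_embedding i -> separable V -> dual_pairing D ->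
  (forall n, `|(u n).1| <= M) -> (forall n, `|(u n).2| <= M) ->
  exists (phi : nat -> nat) (w : W) (y : Y),
    [/\ {homo phi : m n / (m < n)%N},
        (fun n => i (u (phi n)).1) @ \oo --> w
      & weak_star_cvg D (fun n => (u (phi n)).2) y].
Proof.
move=> [_ ci] sepV dpD u1M u2M.
have [U [UU ooU]] := ultraFilterLemma eventually_filter.
have PU := @ultra_proper _ _ UU.
have [w _ Uw] : exists2 w, closure (i @` [set x | `|x| <= M]) w &
    (fun n => i (u n).1) @ U --> w.
  apply: (@ultra_cvg_compact _ _ U).
    rewrite -precompactE; apply: ci; exists M; split; first exact: num_real.
    by move=> M' MM' x /= xM; rewrite (le_trans xM)// ltW.
  by move=> n; apply: subset_closure; exists (u n).1 => //=.
have DM n v : `|D (u n).2 v| <= M * `|v|.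
  by rewrite (le_trans (dual_pairing_le dpD _ _))// ler_wpM2r.
(* As in the Banach-Alaoglu theorem, compact intervals give pointwise limits along [U]; [L] inherits
   linearity and the bound, so the duality represents it by some [y]. *)
have /choice[L UL] v : exists l : R, `|l| <= M * `|v| /\
    (fun n => D (u n).2 v : R) @ U --> l.
  have [||l] := @ultra_cvg_compact _ R U (fun n => D (u n).2 v)
    `[- (M * `|v|), M * `|v|] UU.
  - exact: segment_compact.
  - by move=> n /=; rewrite in_itv /= -ler_norml.
  by rewrite /= in_itv /= -ler_norml; exists l.
have linL : linear (L : V -> R^o).
  move=> a v v'; apply: (@cvg_unique _ (@norm_hausdorff _ _)
    ((fun n => D (u n).2 (a *: v + v') : R) @ U)).
    by case: (UL (a *: v + v')).
  have DE n : D (u n).2 (a *: v + v') = a * D (u n).2 v + D (u n).2 v'.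
    by rewrite linearDr linearZr_LR.
  rewrite (_ : (fun n => _) = (fun n => a * D (u n).2 v + D (u n).2 v'));
    last by apply/funext => n; exact: DE.
  by apply: cvgD; [apply: cvgMr|]; [case: (UL v)|case: (UL v')].
have [f fL] := dual_of_bounded linL (fun v => (UL v).1).
have [_ /(_ f)[y yf] _] := dpD.
have [e e_dense] := separable_dense_seq sepV.
pose P l m := [set n |
  `|D y (e l) - D (u n).2 (e l)| < m.+1%:R^-1 /\
  `|w - i (u n).1| < m.+1%:R^-1].
have UP l m : U (P l m).
  have m0 : 0 < m.+1%:R^-1 :> R by rewrite invr_gt0.
  apply: filterI.
    have := (UL (e l)).2; rewrite -fL -yf.
    by move=> /cvgrPdist_lt/(_ _ m0).
  by move/cvgrPdist_lt : Uw => /(_ _ m0).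
have [phi [phi_homo phiP]] := filter_subsequence PU ooU UP.
exists phi, w, y; split => //.
  apply/cvgrPdist_lt => r r0.
  have /cvgr_lt/(_ _ r0) := @cvg_harmonic R; apply: filterS => n nr.
  by rewrite (lt_trans _ nr)//; case: (phiP 0 n (leq0n n)).
apply: weak_star_cvgW => v; apply/cvgrPdist_lt => r r0.
(* [K] dominates the bound [M] plus the norm of [y] on the difference of the functionals, so
   replacing [v] by [e l] costs at most [r / 2]; the summand 1 keeps [K] positive. *)
pose K := `|M| + `|y| + 1.
have K0 : 0 < K by rewrite /K; have := normr_ge0 M; have := normr_ge0 y; lra.
have [l vl] : exists l, `|v - e l| < r / 2 / K.
  have rK : 0 < r / 2 / K by rewrite !divr_gt0.
  have [l] := e_dense v _ (nbhsx_ballx v _ rK).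
  by rewrite -ball_normE; exists l.
have r20 : 0 < r / 2 by rewrite divr_gt0.
have /cvgr_lt/(_ _ r20) := @cvg_harmonic R; apply: filterS2 (nbhs_infty_ge l).
move=> n /= ln nr; have [Dl _] := phiP l n ln.
have -> : D y v - D (u (phi n)).2 v = (D y (v - e l) - D (u (phi n)).2 (v - e l))
    + (D y (e l) - D (u (phi n)).2 (e l)).
  by rewrite !linearBr; ring.
have D1 := dual_pairing_le dpD y (v - e l).
have D2 := DM (phi n) (v - e l).
have D3 : (M + `|y|) * `|v - e l| <= r / 2.
  move: vl; rewrite ltr_pdivlMr// => /ltW; apply: le_trans.
  rewrite mulrC ler_wpM2l// /K; have := ler_norm M; lra.
apply: le_lt_trans (ler_normD _ _) _; rewrite (splitr r).
apply: ler_ltD; last exact: lt_trans Dl nr.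
by apply: le_trans (ler_normB _ _) _; nra.
Qed.

(** * Eventual inequalities, then the minimization theorem *)

Lemma cvge_near_lt (T : Type) (R : realType) (F : set_system T) (f : T -> \bar R)
    (l c : \bar R) : Filter F ->
  f @ F --> l -> (l < c)%E -> \forall t \near F, (f t < c)%E.
Proof.
move=> FF fl lc; have lO : nbhs l [set z | (z < c)%E].
  by apply: open_nbhs_nbhs; split => //; exact: open_ereal_lt_ereal.
exact: (fl _ lO).
Qed.

Lemma cvge_near_gt (T : Type) (R : realType) (F : set_system T) (f : T -> \bar R)
    (l c : \bar R) : Filter F ->
  f @ F --> l -> (c < l)%E -> \forall t \near F, (c < f t)%E.
Proof.
move=> FF fl cl; have lO : nbhs l [set z | (c < z)%E].
  by apply: open_nbhs_nbhs; split => //; exact: open_ereal_gt_ereal.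
exact: (fl _ lO).
Qed.

Lemma weak_lsc_near (R : realType) (A : normedModType R) (f : A -> R)
    (u : nat -> A) (a : A) (c : R) : weak_lsc f -> weak_cvg u a -> c < f a ->
  \forall n \near \oo, c < f (u n).
Proof.
move=> lscf ua; rewrite -lte_fin => /lscf[B aB Bf].
have uB : \forall n \near \oo, B (u n) := ua B aB.
by apply: filterS uB => n /Bf; rewrite lte_fin.
Qed.

Lemma near_infty_subseq (phi : nat -> nat) (P : nat -> Prop) :
  {homo phi : m n / (m < n)%N} -> (\forall k \near \oo, P k) ->
  \forall n \near \oo, P (phi n).
Proof.
move=> phi_homo [N _ NP]; exists N => // n /= Nn; apply: NP => /=.
apply: leq_trans Nn _; elim: n => // n IH.
exact: leq_ltn_trans IH (phi_homo _ _ (ltnSn n)).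
Qed.

Theorem theorem2p9 (R : realType)
  (X W V Z : completeNormedModType R) (Y : normedModType R)
  (dot : {dot X for (@idfun R)}) (D : {bilinear Y -> V -> R^o})
  (iX : {linear X -> W}) (iY : {linear Y -> W}) (iZ : {linear Z -> Y})
  (psi : R -> Y -> \bar R) (psi0 : Y -> \bar R)
  (eta : X -> R) (j : Y -> R) (beta : R)
  (Xk : nat -> set (X * Z)) (v : R -> nat -> X * Z)
  (* psi gamma takes values in R ∪ {+oo} *)
  (psi_gtNy : forall gamma y, 0 < gamma -> (-oo < psi gamma y)%E)
  (P1 : [/\ hilbert_norm dot, separable W & compact_embedding iX])
  (P2 : separable V /\ dual_pairing D)
  (P3 : continuous_embedding iY)
  (P4 : forall (u : nat -> X * Y) (xhat : X) (ybar : Y),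
     (forall k, capXY iX iY (u k)) ->
     weak_cvg (fun k => (u k).1) xhat ->
     weak_star_cvg D (fun k => (u k).2) ybar ->
     iX xhat = iY ybar)
  (P5 : forall gamma, 0 < gamma -> weak_star_seq_lsc D (psi gamma))
  (P6 : weak_lsc eta)
  (P7 : forall (u : nat -> Y) (y : Y),
     iY \o u @ \oo --> iY y -> j \o u @ \oo --> j y)
  (P8 : [/\ exists c : R, forall p, capXY iX iY p -> c <= j p.2,
            forall gamma, 0 < gamma ->
              exists c : R, forall p, capXY iX iY p -> (c%:E <= psi gamma p.2)%E
          & exists c : R, forall p, capXY iX iY p -> c <= eta p.1])
  (P9 : forall gamma (u : nat -> X * Y), 0 < gamma ->
     (forall k, capXY iX iY (u k)) ->
     (exists M : R, forall k,
        (`|psi gamma (u k).2 + (eta (u k).1)%:E| <= M%:E)%E) ->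
     exists M : R, forall k, `|(u k).2| + `|(u k).1| <= M)
  (P10 : continuous_embedding iZ)
  (P11 : [/\ forall k, Xk k `<=` capXZ iX iY iZ,
             forall k, linear_subspace (Xk k),
             forall k, Xk k `<=` Xk k.+1
           & forall w, capXZ iX iY iZ w -> exists u : nat -> X * Z,
               [/\ forall k, Xk k (u k),
                   (fun k => (u k).1) @ \oo --> w.1
                 & exists M : R, forall k, `|(u k).2| <= M]])
  (P12 : forall gamma (u : nat -> Z) (z : Z), 0 < gamma ->
     (exists M : R, forall k, `|u k| <= M) ->
     (fun k => iY (iZ (u k))) @ \oo --> iY (iZ z) ->
     (fun k => psi gamma (iZ (u k))) @ \oo --> psi gamma (iZ z))
  (P13 : continuous eta)
  (P14 : forall y gamma1 gamma2, 0 < gamma1 -> gamma1 <= gamma2 ->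
     (psi gamma2 y <= psi gamma1 y)%E)
  (P15 : [/\ 0 < beta,
             forall z, psi0 (iZ z) = (beta * `|z|)%:E,
             forall y, ~ range iZ y -> psi0 y = +oo%E
           & forall y, psi gamma y @[gamma --> 0^'+] --> psi0 y])
  (v_min : forall gamma k, 0 < gamma ->
     global_minimizer (Xk k) (objective iZ j (psi gamma) eta) (v gamma k)) :
  exists gamma : nat -> R,
    [/\ forall k, 0 < gamma k,
        gamma @ \oo --> 0,
        exists (phi : nat -> nat) (vbar : X * Z),
          [/\ {homo phi : m n / (m < n)%N},
              cvg_WXY iX D (fun n => XZ_to_XY iZ (v (gamma (phi n)) (phi n)))
                (XZ_to_XY iZ vbar)
            & global_minimizer (capXZ iX iY iZ)
                (limit_objective iZ j beta eta) vbar]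
      & forall (phi : nat -> nat) (q : X * Y),
          {homo phi : m n / (m < n)%N} ->
          capXY iX iY q ->
          cvg_WXY iX D (fun n => XZ_to_XY iZ (v (gamma (phi n)) (phi n))) q ->
          exists2 vbar : X * Z, XZ_to_XY iZ vbar = q &
            global_minimizer (capXZ iX iY iZ)
              (limit_objective iZ j beta eta) vbar].
Proof.
have [hX _ iXc] := P1; have iX_cont := compact_embedding_continuous iXc.
have [sepV dpD] := P2.
have [[cj cjP] cpsi [ce ceP]] := P8.
have [Xk_cap _ _ Xk_dense] := P11.
have [beta0 psi0Z psi0NZ psi_cvg] := P15.
pose J := limit_objective iZ j beta eta.
pose S := capXZ iX iY iZ.
have cap_XY p : S p -> capXY iX iY (XZ_to_XY iZ p) by [].
have psi_le g z : 0 < g -> (psi g (iZ z) <= (beta * `|z|)%:E)%E.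
  move=> g0; rewrite -psi0Z.
  by apply: nonincreasing_at_right_le (psi_cvg (iZ z)) => // x y; exact: P14.
have J_lb p : S p -> cj + ce <= J p.
  move=> Sp; have := cjP _ (cap_XY _ Sp); have := ceP _ (cap_XY _ Sp).
  rewrite /J /limit_objective /=.
  by have : 0 <= beta * `|p.2| by [rewrite mulr_ge0// ltW]; lra.
pose m := inf (J @` S).
have hasinf : has_inf (J @` S).
  split; last by exists (cj + ce) => _ [p Sp <-]; exact: J_lb.
  by exists (J (0, 0)), (0, 0) => //; rewrite /S /capXZ /= !linear0.
have m_le p : S p -> m <= J p.
  by move=> Sp; apply: ge_inf; [case: hasinf|exists p].
have upper g e : 0 < g -> 0 < e ->
    \forall k \near \oo, (objective iZ j (psi g) eta (v g k) <= (m + e)%:E)%E.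
  move=> g0 e0; have [_ [p Sp <-] Jp] := inf_adherent e0 hasinf.
  have [u [Xu up [M uM]]] := Xk_dense _ Sp.
  (* (P7) and (P12) ask for convergence in [W]; it comes from strong convergence in [X], both
     components having the same image in [W]. *)
  have iu : (fun k => iY (iZ (u k).2)) @ \oo --> iY (iZ p.2).
    rewrite -Sp (_ : (fun k => _) = fun k => iX (u k).1).
      by apply: (cvg_comp _ _ up); exact: iX_cont.
    by apply/funext => k; rewrite -(Xk_cap _ _ (Xu k)).
  (* The slack in [J p < m + e] is shared equally by [j], [psi g] and [eta]. *)
  pose d := (m + e - J p) / 3.
  have d0 : 0 < d by rewrite divr_gt0// subr_gt0.
  have je : (fun k => j (iZ (u k).2)) @ \oo --> j (iZ p.2).
    exact: (P7 (fun k => iZ (u k).2)).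
  have ee : (fun k => eta (u k).1) @ \oo --> eta p.1.
    by apply: (cvg_comp _ _ up); exact: P13.
  have pe : (fun k => psi g (iZ (u k).2)) @ \oo --> psi g (iZ p.2).
    by apply: P12 => //; exists M.
  have jd : j (iZ p.2) < j (iZ p.2) + d by rewrite ltrDl.
  have ed : eta p.1 < eta p.1 + d by rewrite ltrDl.
  have pd : (psi g (iZ p.2) < (beta * `|p.2| + d)%:E)%E.
    by rewrite (le_lt_trans (psi_le g _ g0))// lte_fin ltrDl.
  near=> k.
  have [_ /(_ (u k) (Xu k))/le_trans] := v_min g k g0; apply.
  have j1 : j (iZ (u k).2) < j (iZ p.2) + d by near: k; exact: (cvgr_lt _ je).
  have e1 : eta (u k).1 < eta p.1 + d by near: k; exact: (cvgr_lt _ ee).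
  have : (psi g (iZ (u k).2) < (beta * `|p.2| + d)%:E)%E.
    by near: k; exact: cvge_near_lt pe pd.
  (* This and the strict upper bound leave only a real value of [psi g]. *)
  have := psi_gtNy g (iZ (u k).2) g0.
  rewrite /objective; case: (psi g _) => [r||]//= _.
  rewrite lte_fin -!EFinD lee_fin => r1.
  have : d * 3 = m + e - J p by rewrite /d divfK.
  by rewrite /J /limit_objective; lra.
pose gam (n : nat) : R := n.+1%:R^-1.
have gam0 n : 0 < gam n by rewrite invr_gt0.
(* Parameter and tolerance are both [gam n], so one diagonal choice drives both to zero. *)
have [N [N_oo N_upper]] :=
  diagonal_index (fun n => upper _ _ (gam0 n) (gam0 n)).
pose gamma k := gam (N k).
have gamma0 k : 0 < gamma k by exact: gam0.
have gamma_lt e : 0 < e -> \forall k \near \oo, gamma k < e.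
  move=> e0; have /cvgr_lt/(_ _ e0)[n _ ne] := @cvg_harmonic R.
  by apply: filterS (N_oo n) => k nk; exact: (ne (N k)).
have gamma_cvg : gamma @ \oo --> (0 : R).
  apply/cvgrPdist_lt => e e0; apply: filterS (gamma_lt e e0) => k.
  by rewrite sub0r normrN gtr0_norm.
have upper_gamma e : 0 < e -> \forall k \near \oo,
    (objective iZ j (psi (gamma k)) eta (v (gamma k) k) <= (m + e)%:E)%E.
  move=> e0; have ge := gamma_lt e e0; near=> k.
  apply: (@le_trans _ _ (m + gamma k)%:E); first by near: k; exact: N_upper.
  by rewrite lee_fin lerD2l ltW//; near: k.
have Sv k : S (v (gamma k) k).
  by apply: (Xk_cap k); case: (v_min (gamma k) k (gamma0 k)).
(* This is the final assertion on arbitrary subsequences; it also handles the limit of the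
   subsequence obtained by compactness below. *)
have limit_min (phi : nat -> nat) (q : X * Y) :
    {homo phi : m n / (m < n)%N} -> capXY iX iY q ->
    cvg_WXY iX D (fun n => XZ_to_XY iZ (v (gamma (phi n)) (phi n))) q ->
    exists2 vbar : X * Z, XZ_to_XY iZ vbar = q & global_minimizer S J vbar.
  move=> phi_homo qXY [/= cW cX cY].
  pose y n := iZ (v (gamma (phi n)) (phi n)).2.
  pose x n := (v (gamma (phi n)) (phi n)).1.
  have jc : (fun n => j (y n)) @ \oo --> j q.2.
    apply: (P7 y); rewrite -qXY (_ : iY \o y = fun n => iX (x n))//.
    by apply/funext => n; rewrite /= -(Sv (phi n)).
  (* The real [c] stands in for [psi dl q.2], which may still be infinite. The thirds of [e] pay for
     [j], [eta] and the excess of the discrete minimal value over [m]. *)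
  have lower dl c : 0 < dl -> (c%:E < psi dl q.2)%E -> j q.2 + c + eta q.1 <= m.
    move=> dl0 c_lt; apply/ler_addgt0Pr => e e0.
    have e30 : 0 < e / 3 by rewrite divr_gt0.
    have c_lt' := limn_einf_gt (lt_le_trans c_lt (P5 dl dl0 _ _ cY)).
    have je : j q.2 - e / 3 < j q.2 by rewrite ltrBlDr ltrDl.
    have ee : eta q.1 - e / 3 < eta q.1 by rewrite ltrBlDr ltrDl.
    near \oo => n.
    have n1 : j q.2 - e / 3 < j (y n) by near: n; exact: (cvgr_gt _ jc).
    have n2 : eta q.1 - e / 3 < eta (x n).
      by near: n; exact: weak_lsc_near P6 cX ee.
    have n3 : (c%:E < psi dl (y n))%E by near: n.
    (* From here on [psi dl] lies below [psi (gamma (phi n))], which the minimal value controls. *)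
    have n4 : gamma (phi n) < dl.
      by near: n; exact: (near_infty_subseq phi_homo (gamma_lt _ dl0)).
    have : (objective iZ j (psi (gamma (phi n))) eta (v (gamma (phi n)) (phi n))
            <= (m + e / 3)%:E)%E.
      by near: n; exact: (near_infty_subseq phi_homo (upper_gamma _ e30)).
    have := lt_le_trans n3 (P14 _ _ _ (gamma0 _) (ltW n4)).
    rewrite /objective -/(y n) -/(x n); case: (psi _ _) => [r||]//=.
    by rewrite lte_fin -!EFinD lee_fin; lra.
  have lower0 c : (c%:E < psi0 q.2)%E -> j q.2 + c + eta q.1 <= m.
    move=> c_lt; near (0 : R)^'+ => dl; apply: (lower dl).
      by near: dl; exact: nbhs_right_gt.
    by near: dl; exact: cvge_near_gt (psi_cvg q.2) c_lt.
  (* Outside the range [psi0] is infinite and [lower0] accepts every real [c]; the chosen one makes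
     its left side [m + 1]. *)
  have [z _ zq] : range iZ q.2.
    apply: contrapT => /psi0NZ psi0y.
    have := lower0 (m - j q.2 - eta q.1 + 1); rewrite psi0y ltry => /(_ isT).
    lra.
  exists (q.1, z); first by rewrite /XZ_to_XY /= zq -surjective_pairing.
  have Sq : S (q.1, z) by rewrite /S /capXZ /= zq.
  split => // p Sp; apply: le_trans (m_le _ Sp).
  apply/ler_addgt0Pr => e e0; rewrite /J /limit_objective /= zq.
  (* [lower0] wants a strict inequality, hence the loss of an arbitrary [e]. *)
  have := lower0 (beta * `|z| - e); rewrite -zq psi0Z lte_fin ltrBlDr ltrDl.
  by move=> /(_ e0); lra.
exists gamma; split => //.
have [K0 _ K0P] := upper_gamma 1 ltr01.
(* (P9) asks for a bound at every index, so the sequence starts at [K0], from which on the minimal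
   values are at most [m + 1]. *)
pose u n := XZ_to_XY iZ (v (gamma (K0 + n)) (K0 + n)%N).
have uXY n : capXY iX iY (u n) by exact: Sv.
have [c1 c1P] := cpsi 1 ltr01.
have [M uM] : exists M : R, forall k, `|(u k).2| + `|(u k).1| <= M.
  (* (P8) bounds the sum below by [c1 + ce]; it is at most [m + 1 - cj] because [gamma <= 1] puts
     [psi 1] below [psi (gamma k)]. *)
  apply: (P9 1) => //; exists (`|c1 + ce| + `|m + 1 - cj|) => n.
  have := K0P (K0 + n)%N (leq_addr _ _).
  have g1 : gamma (K0 + n) <= 1 by rewrite invf_le1 ?ler1n.
  have := P14 (u n).2 _ _ (gamma0 _) g1.
  have := c1P _ (uXY n); have := cjP _ (uXY n); have := ceP _ (uXY n).
  rewrite /objective -[iZ _]/((u n).2) -[X in eta X]/((u n).1).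
  case: (psi 1 _) => [r||]//; case: (psi _ _) => [s||]//=.
  rewrite -!EFinD !lee_fin ler_norml.
  have := ler_norm (- (c1 + ce)); have := ler_norm (m + 1 - cj).
  have := normr_ge0 (c1 + ce); have := normr_ge0 (m + 1 - cj).
  by rewrite normrN; lra.
have u1M n : `|(u n).1| <= M by have := uM n; have := normr_ge0 (u n).2; lra.
have u2M n : `|(u n).2| <= M by have := uM n; have := normr_ge0 (u n).1; lra.
have [phi [w [y [phi_homo uw uy]]]] := bounded_subsequence iXc sepV dpD u1M u2M.
(* The limit in [W] yields the weak limit in [X], and (P4) then matches it with the weak-star limit
   in [Y]. *)
have [x xw ux] := hilbert_bounded_weak_cvg hX iXc.1 iX_cont
  (fun n => u1M (phi n)) uw.
have xy : iX x = iY y by exact: (P4 (u \o phi) x y (fun n => uXY (phi n)) ux uy).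
pose phi' n := (K0 + phi n)%N.
have phi'_homo : {homo phi' : m n / (m < n)%N}.
  by move=> a b /phi_homo; rewrite ltn_add2l.
have cvg_xy : cvg_WXY iX D (fun n => XZ_to_XY iZ (v (gamma (phi' n)) (phi' n)))
    (x, y) by split => //=; rewrite xw.
have [vbar vbarE vbar_min] := limit_min phi' (x, y) phi'_homo xy cvg_xy.
by exists phi', vbar; rewrite vbarE.
Unshelve. all: by end_near. Qed.
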